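(* Let $k$ be a field and let $A$ be a prime finitely generated $k$-algebra with infinite centre. Then, for every $d\ge 1$, $\mathrm{ML}^{H'}(A)=\mathrm{ML}^{H'}(A[x_1,x_2,\ldots,x_d])$ (as subsets of $A[x_1,\ldots,x_d]$). In particular, if, in addition, $A$ is left Goldie, has finite Gelfand-Kirillov dimension, its centre $Z(A)$ is affine, and either $\mathrm{ML}^{H'}_Z(A)=Z(A)$ or $\mathrm{ML}^{H'}(A)=A$, then $A$ is strongly cancellative.
   Context: Algebras are associative and unital, not necessarily commutative; $Z(A)$ denotes the centre of $A$; affine means finitely generated as a $k$-algebra; $A[x_1,\ldots,x_d]$ is the polynomial ring in commuting central variables. A Hasse-Schmidt derivation of a $k$-algebra $A$ is a sequence $\partial=(\partial_n)_{n\ge 0}$ of $k$-linear maps $A\to A$ with $\partial_0=\mathrm{id}_A$ and $\partial_n(ab)=\sum_{i=0}^n\partial_i(a)\partial_{n-i}(b)$ for all $a,b\in A$, $n\ge 0$. It is weakly locally nilpotent if for each $a\in A$ there is $N=N(a)\ge 0$ with $\partial_n(a)=0$ for all $n\ge N$. Let $\mathrm{LND}^{H'}(A)$ be the set of weakly locally nilpotent Hasse-Schmidt derivations of $A$, and let $\ker(\partial)=\bigcap_{i\ge 1}\ker(\partial_i)$. Define $$\mathrm{ML}^{H'}(A)=\bigcap_{\partial\in \mathrm{LND}^{H'}(A)}\ker(\partial),\qquad \mathrm{ML}^{H'}_Z(A)=\mathrm{ML}^{H'}(A)\cap Z(A).$$ A $k$-algebra $A$ is strongly cancellative if for every $d\ge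 1$ and every $k$-algebra $B$, an isomorphism $A[t_1,\ldots,t_d]\cong B[t_1,\ldots,t_d]$ of $k$-algebras implies $A\cong B$ as $k$-algebras. *)

(* Defs.v *)
From HB Require Import structures.
From mathcomp Require Import all_boot all_order all_algebra.
From mathcomp Require Import all_classical all_reals all_analysis.
From mathcomp Require Export Rstruct.
From mathcomp Require Import (canonicals) mpoly.

Set Implicit Arguments.
Unset Strict Implicit.
Unset Printing Implicit Defensive.

Import Order.TTheory GRing.Theory Num.Theory.

Local Open Scope classical_set_scope.
Local Open Scope ring_scope.

(* In [{mpoly A[d]}] the coefficients commute with the variables but not with
   each other.  The library makes it a left module over [A]; the alias
   [polyalg A d] carries instead the structure of a [k]-algebra, with
   [c *: p] the product of [p] by the scalar [c%:A] of [A]. *)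
Definition polyalg (k : fieldType) (A : algType k) (d : nat) : Type :=
  mpoly.mpoly d A.

Section PolyAlg.
Variables (k : fieldType) (A : algType k) (d : nat).

HB.instance Definition _ := GRing.NzRing.copy (polyalg A d) (mpoly.mpoly d A).

Definition polyalgC (a : A) : polyalg A d := mpoly.mpolyC d a.

Definition polyalg_scale (c : k) (p : polyalg A d) : polyalg A d :=
  @GRing.scale A (mpoly.mpoly d A) c%:A p.

Fact polyalg_scaleA (a b : k) (p : polyalg A d) :
  polyalg_scale a (polyalg_scale b p) = polyalg_scale (a * b) p.
Proof. by rewrite /polyalg_scale scalerA -scalerAl mul1r scalerA. Qed.

Fact polyalg_scale1 : left_id 1 polyalg_scale.
Proof. by move=> p; rewrite /polyalg_scale !scale1r. Qed.

Fact polyalg_scaleDr : right_distributive polyalg_scale +%R.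
Proof. by move=> c p q; rewrite /polyalg_scale scalerDr. Qed.

Fact polyalg_scaleDl (p : polyalg A d) :
  {morph (polyalg_scale)^~ p : a b / a + b}.
Proof. by move=> a b; rewrite /polyalg_scale !scalerDl. Qed.

HB.instance Definition _ := GRing.Zmodule_isLmodule.Build k (polyalg A d)
  polyalg_scaleA polyalg_scale1 polyalg_scaleDr polyalg_scaleDl.

Fact polyalg_scaleAl (c : k) (p q : polyalg A d) : c *: (p * q) = c *: p * q.
Proof. exact: (@scalerAl A (mpoly.mpoly d A)). Qed.

HB.instance Definition _ :=
  GRing.Lmodule_isLalgebra.Build k (polyalg A d) polyalg_scaleAl.

Fact polyalg_scaleAr (c : k) (p q : polyalg A d) : c *: (p * q) = p * (c *: q).
Proof.
apply/mpoly.mpolyP => m.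
rewrite [LHS]mpoly.mcoeffZ !mpoly.mcoeffM mulr_sumr; apply: eq_bigr => i _.
by rewrite mpoly.mcoeffZ -scalerAl mul1r -scalerAl mul1r scalerAr.
Qed.

HB.instance Definition _ :=
  GRing.Lalgebra_isAlgebra.Build k (polyalg A d) polyalg_scaleAr.

End PolyAlg.

Arguments polyalgC {k A} d a.

Definition alg_iso (k : fieldType) (A B : algType k) : Prop :=
  exists f : {lrmorphism A -> B}, bijective f.

Definition strongly_cancellative (k : fieldType) (A : algType k) : Prop :=
  forall d : nat, (1 <= d)%N -> forall B : algType k,
    alg_iso (polyalg A d) (polyalg B d) -> alg_iso A B.

Section HasseSchmidt.
Variables (k : fieldType) (A : algType k).

Definition hasse_schmidt (D : nat -> {linear A -> A}) : Prop :=
  D 0%N =1 id /\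
  forall n (a b : A), D n (a * b) = \sum_(i < n.+1) D i a * D (n - i)%N b.

Definition weakly_locally_nilpotent (D : nat -> {linear A -> A}) : Prop :=
  forall a : A, exists N : nat, forall n, (N <= n)%N -> D n a = 0.

Definition LNDH' : set (nat -> {linear A -> A}) :=
  [set D | hasse_schmidt D /\ weakly_locally_nilpotent D].

Definition HSker (D : nat -> {linear A -> A}) : set A :=
  \bigcap_(i in [set i : nat | (1 <= i)%N]) [set a | D i a = 0].

Definition MLH' : set A := \bigcap_(D in LNDH') HSker D.

Definition centre : set A := [set a | forall b, GRing.comm a b].

Definition MLH'Z : set A := MLH' `&` centre.

End HasseSchmidt.

Arguments LNDH' {k} A.
Arguments MLH' {k} A.
Arguments centre {k} A.
Arguments MLH'Z {k} A.

Definition subalg_gen (k : fieldType) (A : algType k) (S : set A) : set A :=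
  smallest [set T : set A | GRing.subalg_closed [in T]] S.

(* Affineness is stated for a subset of [A] so that it applies to the centre,
   which is not a type; [A] itself is affine when [affine [set: A]]. *)
Definition affine (k : fieldType) (A : algType k) (S : set A) : Prop :=
  exists s : seq A, S = subalg_gen [set` s].

Section Ideals.
Variable (A : nzRingType).

Definition left_ideal (I : set A) : Prop :=
  GRing.zmod_closed [in I] /\ forall a x, I x -> I (a * x).

Definition right_ideal (I : set A) : Prop :=
  GRing.zmod_closed [in I] /\ forall a x, I x -> I (x * a).

Definition two_sided_ideal (I : set A) : Prop := left_ideal I /\ right_ideal I.

(* The ring is nonzero by its type, so this says that (0) is a prime ideal;
   I J = 0 means that all products of elements of I and J vanish. *)
Definition prime_ring : Prop :=
  forall I J : set A, two_sided_ideal I -> two_sided_ideal J ->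
    (forall x y, I x -> J y -> x * y = 0) -> I = [set 0] \/ J = [set 0].

Definition left_annihilator (S : set A) : set A :=
  [set a | forall s, S s -> a * s = 0].

Definition acc_left_annihilators : Prop :=
  forall S : nat -> set A,
    (forall n, left_annihilator (S n) `<=` left_annihilator (S n.+1)) ->
    exists N, forall n, (N <= n)%N ->
      left_annihilator (S n) = left_annihilator (S N).

Definition independent_family (I : nat -> set A) : Prop :=
  forall n (x : 'I_n -> A), (forall i : 'I_n, I i (x i)) ->
    \sum_(i < n) x i = 0 -> forall i, x i = 0.

Definition left_goldie : Prop :=
  acc_left_annihilators /\
  ~ exists I : nat -> set A,
      [/\ forall n, left_ideal (I n), forall n, I n <> [set 0]
        & independent_family I].

End Ideals.

Arguments prime_ring : clear implicits.
Arguments left_goldie : clear implicits.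

Section Dimension.
Variables (k : fieldType) (V : lmodType k).

Definition subspace_gen (S : set V) : set V :=
  smallest [set W : set V | GRing.submod_closed [in W]] S.

Definition lin_indep n (v : 'I_n -> V) : Prop :=
  forall c : 'I_n -> k, \sum_(i < n) c i *: v i = 0 -> forall i, c i = 0.

Definition has_dim (W : set V) (n : nat) : Prop :=
  exists v : 'I_n -> V, lin_indep v /\ W = subspace_gen (range v).

Definition fin_dim (W : set V) : Prop := exists n, has_dim W n.

(* Meaningful only when [fin_dim W]; the default value is 0. *)
Definition dim (W : set V) : nat := xget 0%N [set n | has_dim W n].

End Dimension.

Section GelfandKirillov.
Variables (k : fieldType) (A : algType k).

(* k + W + W^2 + ... + W^n *)
Definition power_sum (W : set A) (n : nat) : set A :=
  subspace_gen
    [set \prod_(x <- w) x | w in [set w : seq A |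
       (size w <= n)%N /\ [set` w] `<=` W]].

(* GKdim(A) = sup_W limsup_n log_n dim(k + W + ... + W^n), where W ranges over
   the finite-dimensional subspaces of A. *)
Definition GKdim : \bar Rdefinitions.R :=
  ereal_sup [set limn_esup (fun n : nat =>
      (ln ((dim (power_sum W n))%:R : Rdefinitions.R) / ln n%:R)%:E)
    | W in [set W : set A | fin_dim W]].

End GelfandKirillov.

Arguments GKdim {k} A.

(* Main.v *)
Require Import Defs.
From HB Require Import structures.
From mathcomp Require Import all_boot all_order all_algebra.
From mathcomp Require Import all_classical all_reals all_analysis.
From mathcomp Require Import -(notations) mpoly.

(** The invariant of the polynomial algebra.  A weakly locally nilpotent
    Hasse-Schmidt derivation of [A] amounts to an algebra morphism A -> A[t]
    which is the identity modulo t.  On A[x_1, ..., x_d], scaling the variables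
    by 1 + t is such a morphism and fixes only the constants, and derivations of
    [A] extend coefficient by coefficient; hence the invariant of
    A[x_1, ..., x_d] consists of elements of the invariant of [A]
    ([polyalg_MLH'_sub]).  Conversely, a derivation of A[x_1, ..., x_d]
    restricts to A -> A[x_1, ..., x_d][t], and substituting positive powers of t
    for the x_i produces derivations of [A].  Sparse powers keep apart the
    finitely many coefficients met at a given element, so an element of the
    invariant of [A] is killed by the original derivation ([polyalgC_MLH']).

    Cancellation.  Let [phi] be an isomorphism from A[x_1, ..., x_d] to
    B[x_1, ..., x_d] with inverse [psi].  Central elements of [A] belong to the
    invariant, which isomorphisms preserve, so [phi] maps them to constants of
    [B].  Nonzero central elements of a prime ring are regular, so the centre of
    [A] is a domain and transcendence degrees over it make sense.  Over this
    domain A[x_1, ..., x_d] has room for only [d] algebraically independent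
    central elements, and the psi(x_i) already use it up: thus a central element
    of [B] is mapped by [psi] to an algebraic element, that is, to a constant
    ([centre_inverse]).  The two centres being identified, [A] and [B] are the
    quotients of one algebra by one ideal, generated on one side by the
    variables and on the other by the differences between variables and central
    constants ([alg_iso_of_stable_iso]). *)

Set Implicit Arguments.
Unset Strict Implicit.
Unset Printing Implicit Defensive.

Import Order.TTheory GRing.Theory Num.Theory.

Local Open Scope classical_set_scope.
Local Open Scope ring_scope.

(** * Morphisms between polynomial algebras *)

Definition linear_of (k : fieldType) (U V : lmodType k) (f : U -> V)
    (f_lin : linear f) : {linear U -> V} :=
  HB.pack f (GRing.isLinear.Build k U V *:%R f f_lin).

Definition rmorphism_of (R S : nzRingType) (f : R -> S)
    (f_add : zmod_morphism f) (f_mul : monoid_morphism f) :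
    {rmorphism R -> S} :=
  HB.pack f (GRing.isZmodMorphism.Build R S f f_add)
            (GRing.isMonoidMorphism.Build R S f f_mul).

Definition lrmorphism_of (k : fieldType) (A B : algType k) (f : A -> B)
    (f_lin : linear f) (f_mul : monoid_morphism f) : {lrmorphism A -> B} :=
  HB.pack f (GRing.isLinear.Build k A B *:%R f f_lin)
            (GRing.isMonoidMorphism.Build A B f f_mul).

Lemma inverse_lrmorphism (k : fieldType) (A B : algType k)
    (f : {lrmorphism A -> B}) :
  bijective f -> exists g : {lrmorphism B -> A}, cancel f g /\ cancel g f.
Proof.
move=> [g fK gK].
by exists (lrmorphism_of (can2_linear fK gK) (can2_monoid_morphism fK gK)).
Qed.

Section PolyalgMorphisms.
Variables (k : fieldType) (A : algType k) (d : nat).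

Fact polyalgC_linear : linear (@polyalgC k A d).
Proof.
move=> c a b; apply/mpolyP => m.
by rewrite mcoeffD [in RHS]mcoeffZ !mcoeffC mulrDl -scalerAl -!scalerAl mul1r.
Qed.

Fact polyalgC_monoid : monoid_morphism (@polyalgC k A d).
Proof. by split=> // a b; apply: rmorphM. Qed.

HB.instance Definition _ :=
  GRing.isLinear.Build k A (polyalg A d) *:%R (@polyalgC k A d) polyalgC_linear.
HB.instance Definition _ := GRing.isMonoidMorphism.Build A (polyalg A d)
  (@polyalgC k A d) polyalgC_monoid.

Definition constant_term (p : polyalg A d) : A := mcoeff mnm0 p.

Fact constant_term_linear : linear constant_term.
Proof.
move=> c p q; rewrite /constant_term mcoeffD [X in X + _]mcoeffZ.
by rewrite -scalerAl mul1r.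
Qed.

Fact constant_term_monoid : monoid_morphism constant_term.
Proof. by split=> [|p q]; rewrite /constant_term; [exact: rmorph1 | exact: rmorphM]. Qed.

HB.instance Definition _ :=
  GRing.isLinear.Build k (polyalg A d) A *:%R constant_term constant_term_linear.
HB.instance Definition _ := GRing.isMonoidMorphism.Build (polyalg A d) A
  constant_term constant_term_monoid.

Lemma polyalgCK : cancel (@polyalgC k A d) constant_term.
Proof. by move=> a; rewrite /constant_term mcoeffC eqxx mulr1. Qed.

Variables (S : nzRingType) (f : {rmorphism A -> S}) (h : 'I_d -> S).
Hypothesis h_central : forall i x, GRing.comm x (h i).

Lemma mmap1_central m x : GRing.comm x (mmap1 h m).
Proof.
rewrite /mmap1; elim/big_rec: _ => [|i y _ xy]; first exact: commr1.
by apply: commrM => //; apply: commrX.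
Qed.

Fact central_subst_monoid : monoid_morphism (mmap f h : polyalg A d -> S).
Proof.
by have [] := commr_mmap_is_multiplicative h_central
  (fun p m m' => mmap1_central m' (f (mcoeff m p))); split.
Qed.

(** Substitution for the variables is multiplicative as soon as the values are
    central, although the coefficients do not commute. *)
Definition central_subst : {rmorphism polyalg A d -> S} :=
  rmorphism_of (mmap_is_additive h f : zmod_morphism (mmap f h : polyalg A d -> S))
    central_subst_monoid.

Lemma central_substC a : central_subst (polyalgC d a) = f a.
Proof. exact: mmapC. Qed.

Lemma central_substX i : central_subst (mpolyX A (mnm1 i)) = h i.
Proof. by rewrite [LHS]mmapX mmap1U. Qed.

End PolyalgMorphisms.

(** The coefficients and the variables generate the polynomial algebra. *)
Lemma polyalg_morphism_ext (k : fieldType) (A : algType k) (d : nat) (S : nzRingType)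
    (F G : {rmorphism polyalg A d -> S}) :
    (forall a, F (polyalgC d a) = G (polyalgC d a)) ->
    (forall i, F (mpolyX A (mnm1 i)) = G (mpolyX A (mnm1 i))) ->
  F =1 G.
Proof.
move=> FGC FGX p.
have -> : p = (\sum_(m <- msupp p)
   polyalgC d (mcoeff m p) *
     \prod_(i < d) (mpolyX A (mnm1 i) : polyalg A d) ^+ m i :> polyalg A d).
  rewrite {1}(mpolyE p); apply: eq_bigr => m _.
  by rewrite -mul_mpolyC [in LHS]mpolyXE_id.
rewrite !rmorph_sum; apply: eq_bigr => m _; rewrite !rmorphM FGC; congr (_ * _).
by rewrite !rmorph_prod; apply: eq_bigr => i _; rewrite !rmorphXn FGX.
Qed.

(** * Hasse-Schmidt derivations acting monomial by monomial *)

Section CoefficientwiseOperators.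
Variables (k : fieldType) (A : algType k) (d : nat).

Definition coefficientwise_fun (E : multinom d -> A -> A) (p : polyalg A d) :
    polyalg A d :=
  \sum_(m : bmultinom d (msize (p : mpoly d A)))
    (E m (mcoeff m p) *: mpolyX A m : mpoly d A).

Lemma mcoeff_coefficientwise (E : multinom d -> {linear A -> A}) p m :
  mcoeff m (coefficientwise_fun E p) = E m (mcoeff m p).
Proof.
have [lt_m_p|le_p_m] := ltnP (mdeg m) (msize (p : mpoly d A)).
  exact: (mcoeff_mpoly (fun m => E m (mcoeff m p))).
rewrite (_ : mcoeff m p = 0) ?linear0; last first.
  by apply/eqP; rewrite mcoeff_eq0 msize_mdeg_ge.
rewrite raddf_sum big1 // => -[i lt_i_p] _.
rewrite /= mcoeffZ mcoeffX; case: eqP => [im|_]; last by rewrite mulr0.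
by move: lt_i_p; rewrite im ltnNge le_p_m.
Qed.

Fact coefficientwise_linear (E : multinom d -> {linear A -> A}) :
  linear (coefficientwise_fun E).
Proof.
move=> c p q; apply/mpolyP => m; rewrite mcoeff_coefficientwise.
rewrite !mcoeffD !mcoeff_coefficientwise.
rewrite [mcoeff m (c *: p)]mcoeffZ.
rewrite [mcoeff m (c *: coefficientwise_fun E p)]mcoeffZ.
by rewrite mcoeff_coefficientwise -!scalerAl !mul1r linearP.
Qed.

Definition coefficientwise (E : multinom d -> {linear A -> A}) :
    {linear polyalg A d -> polyalg A d} :=
  linear_of (coefficientwise_linear E).

(** The product rule only has to be checked on monomials: the coefficient of a
    product at [m] is a sum over the factorisations of [m], and the rule for
    [E] applies to each of them. *)
Lemma coefficientwise_LND (E : nat -> multinom d -> {linear A -> A}) :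
    (forall m, E 0%N m =1 id) ->
    (forall n m1 m2 a b, E n (mnm_add m1 m2) (a * b) =
       \sum_(i < n.+1) E i m1 a * E (n - i)%N m2 b) ->
    (forall m a, exists N, forall n, (N <= n)%N -> E n m a = 0) ->
  LNDH' (polyalg A d) (fun n => coefficientwise (E n)).
Proof.
move=> E0 EM EN; split; first split.
- by move=> p; apply/mpolyP => m; rewrite mcoeff_coefficientwise E0.
- move=> n p q; apply/mpolyP => m; rewrite mcoeff_coefficientwise.
  rewrite [in LHS]mcoeffM linear_sum raddf_sum /=.
  under [RHS]eq_bigr do rewrite mcoeffM.
  rewrite [RHS]exchange_big; apply: eq_bigr => h /eqP mE.
  transitivity (E n (mnm_add h.1 h.2) (mcoeff h.1 p * mcoeff h.2 q)).
    by congr (E n _ _).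
  by rewrite EM; apply: eq_bigr => i _; rewrite !mcoeff_coefficientwise.
- move=> p; have [N HN] := choice (fun m => EN m (mcoeff m p)).
  exists (\max_(m <- msupp (p : mpoly d A)) N m) => n le_n.
  apply/mpolyP => m; rewrite mcoeff_coefficientwise mcoeff0.
  have [pm|] := boolP (m \in msupp (p : mpoly d A)).
    by apply: HN; apply: leq_trans le_n; apply: leq_bigmax_seq.
  by rewrite -mcoeff_eq0 => /eqP ->; rewrite linear0.
Qed.

End CoefficientwiseOperators.

Lemma digits_inj (N e : nat) (x y : 'I_e -> nat) :
    (forall i, (x i < N)%N) -> (forall i, (y i < N)%N) ->
  (\sum_(i < e) x i * N ^ i = \sum_(i < e) y i * N ^ i)%N -> x =1 y.
Proof.
elim: e x y => [|e IH] x y xN yN; first by move=> _ [].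
have shift (z : 'I_e.+1 -> nat) : (\sum_(i < e.+1) z i * N ^ i =
    (\sum_(i < e) z (lift ord0 i) * N ^ i) * N + z ord0)%N.
  rewrite big_ord_recl expn0 muln1 addnC; congr (_ + _)%N.
  by rewrite big_distrl; apply: eq_bigr => i _; rewrite /= expnSr mulnA.
have N_gt0 : (0 < N)%N by apply: leq_ltn_trans (xN ord0).
rewrite !shift => xy.
have xy0 : x ord0 = y ord0.
  by have := congr1 (modn^~ N) xy; rewrite !modnMDl !modn_small.
move: xy; rewrite xy0 => /addIn/eqP; rewrite eqn_pmul2r // => /eqP xy i.
case: (unliftP ord0 i) => [j ->|-> //].
by apply: (IH (x \o lift ord0) (y \o lift ord0)) xy j => l /=.
Qed.

(** * The Makar-Limanov invariant of a polynomial algebra *)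

Section MakarLimanovPolynomial.
Variables (k : fieldType) (A : algType k) (d : nat).

Fact natmul_linear n : linear (fun a : A => a *+ n).
Proof. by move=> c a b; rewrite mulrnDl scalerMnr. Qed.

(** This is the sequence of coefficients in [t] of the substitution
    x_i |-> (1 + t) x_i.  It multiplies a monomial of degree e by 'C(e, n), so
    the product rule is the Vandermonde identity, and a monomial of degree
    e >= 1 is not killed by the e-th map, whatever the characteristic. *)
Lemma euler_LND :
  LNDH' (polyalg A d)
    (fun n => coefficientwise (fun m => linear_of (natmul_linear 'C(mdeg m, n)))).
Proof.
apply: coefficientwise_LND => [m a|n m1 m2 a b|m a] /=.
- by rewrite bin0.
- rewrite mdegD -binomial.Vandermonde -sumrMnr.
  by apply: eq_bigr => i _; rewrite mulrnAr mulrnAl -mulrnA mulnC.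
- by exists (mdeg m).+1 => n lt_mn; rewrite bin_small.
Qed.

Lemma extend_LND (D : nat -> {linear A -> A}) :
  LNDH' A D -> LNDH' (polyalg A d) (fun n => coefficientwise (fun=> D n)).
Proof.
move=> [[D0 DM] DN]; apply: coefficientwise_LND => [m a|n m1 m2 a b|m a].
- exact: D0.
- exact: DM.
- exact: DN.
Qed.

(** The kernel of [euler_LND] consists of the constants; that a constant of the
    invariant lies in [MLH' A] is seen by extending derivations of [A]. *)
Lemma polyalg_MLH'_sub :
  MLH' (polyalg A d) `<=` [set polyalgC d a | a in MLH' A].
Proof.
move=> p pML.
have p_const : p = polyalgC d (constant_term p).
  apply/mpolyP => m; rewrite mcoeffC /constant_term.
  have [->|m_neq0] := eqVneq m mnm0; first by rewrite mulr1.
  have deg_m : (1 <= mdeg m)%N by rewrite lt0n mdeg_eq0.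
  have /(congr1 (mcoeff m)) := pML _ euler_LND (mdeg m) deg_m.
  by rewrite mcoeff_coefficientwise /= binn mulr1n mulr0 => ->; exact: mcoeff0.
exists (constant_term p) => // D D_LND n n_gt0.
have := pML _ (extend_LND D_LND) n n_gt0.
rewrite /= => /(congr1 (mcoeff mnm0)); rewrite mcoeff_coefficientwise => ->.
exact: mcoeff0.
Qed.

(** A weakly locally nilpotent Hasse-Schmidt derivation is the same thing as an
    algebra morphism A -> A[t] which becomes the identity at t = 0. *)
Lemma LND_of_poly (P : A -> {poly A}) :
    (forall n, linear (fun a => (P a)`_n)) ->
    (forall a b, P (a * b) = P a * P b) -> (forall a, (P a)`_0 = a) ->
  exists2 D, LNDH' A D & forall n a, D n a = (P a)`_n.
Proof.
move=> Plin PM P0; exists (fun n => linear_of (Plin n)) => //.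
split; first split; first exact: P0.
- by move=> n a b; rewrite /= PM coefM.
- by move=> a; exists (size (P a)) => n le_n; rewrite /= nth_default.
Qed.

(** Let [D] be a derivation of the polynomial algebra and [a] in [MLH' A].
    Substituting x_i := t^(N^(i+1)) in the image of [b] under the morphism
    b |-> \sum_n D_n(b) t^n gives a morphism A -> A[t] which is the identity at
    t = 0, hence fixes [a].  If [N] exceeds all the exponents that occur in the
    D_n(a), the coefficient of x^m in D_n(a) ends up alone at the power of t
    whose exponent has digits n, m_0, m_1, ... in base [N]; so it vanishes for
    n >= 1. *)
Lemma polyalgC_MLH' : [set polyalgC d a | a in MLH' A] `<=` MLH' (polyalg A d).
Proof.
move=> _ [a aML <-] D [[D0 DM] DN] n0 n0_gt0.
have [B DB] := choice (fun b => DN (polyalgC d b)).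
pose N := (maxn (B a) (\max_(n < B a) msize (D n (polyalgC d a) : mpoly d A))).+1.
pose w (i : 'I_d) : {poly A} := 'X ^+ (N ^ i.+1).
have w_central i (q : {poly A}) : GRing.comm q (w i).
  by apply: commrX; apply: commr_polyX.
pose ev : {rmorphism polyalg A d -> {poly A}} := central_subst polyC w_central.
(* Q keeps a separate variable for the index of D, so that the product rule
   reads as multiplicativity of Q; P then sets that variable to t. *)
pose Q b := \poly_(n < B b) ev (D n (polyalgC d b)).
have QE b n : (Q b)`_n = ev (D n (polyalgC d b)).
  by rewrite coef_poly; case: ltnP => // /DB ->; rewrite rmorph0.
pose P b := (Q b).['X].
have ev_lin c p q : ev (c *: p + q) = c%:A *: ev p + ev q.
  rewrite rmorphD; congr (_ + _).
  by rewrite -mul_polyC /ev /= [LHS]mmapZ.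
have [] := @LND_of_poly P.
- move=> n c b b'; rewrite /P.
  have -> : Q (c *: b + b') = (c%:A)%:P%:P * Q b + Q b'.
    apply/polyP => i; rewrite coefD coefCM !QE !linearP.
    by rewrite ev_lin mul_polyC.
  by rewrite !hornerE coefD coefCM -scalerAl mul1r.
- move=> b b'; rewrite /P -hornerM_comm; last first.
    by rewrite /comm_poly commr_polyX.
  congr (_.[_]); apply/polyP => n; rewrite coefM QE rmorphM DM rmorph_sum.
  by apply: eq_bigr => i _; rewrite !QE rmorphM.
- move=> b; rewrite /P (horner_coef_wide _ (leqW (size_poly _ _))).
  rewrite big_ord_recl coefD coef_sum big1 => [|i _]; last by rewrite coefMXn.
  by rewrite addr0 expr0 mulr1 QE D0 central_substC coefC.
move=> D' D'_LND D'E.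
pose weight (m : multinom d) := ((\sum_(i < d) m i * N ^ i) * N)%N.
have ev_coef p n l : (ev p * 'X^n)`_l =
    \sum_(m <- msupp (p : mpoly d A)) mcoeff m p *+ (l == weight m + n)%N.
  rewrite /ev /= /mmap mulr_suml coef_sum; apply: eq_bigr => m _.
  have -> : mmap1 w m = 'X^(weight m).
    rewrite /mmap1 /weight big_distrl -prodrXr; apply: eq_bigr => i _ /=.
    by rewrite -exprM -mulnA -expnSr mulnC.
  by rewrite -mulrA -exprD coefCM coefXn mulr_natr.
apply/mpolyP => m0; rewrite mcoeff0; apply/eqP; apply: contraT => pm0.
have n0_lt : (n0 < B a)%N.
  by rewrite ltnNge; apply: contra pm0 => /DB ->; rewrite mcoeff0.
have N_deg n m i : (n < B a)%N -> m \in msupp (D n (polyalgC d a) : mpoly d A) ->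
    (m i < N)%N.
  move=> ltn pm; rewrite ltnS (leq_trans _ (leq_maxr _ _)) //.
  have le_max := @leq_bigmax _ (fun n : 'I_(B a) =>
    msize (D n (polyalgC d a) : mpoly d A)) (Ordinal ltn).
  apply: leq_trans le_max; apply: leq_trans (ltnW (msize_mdeg_lt pm)).
  by rewrite mdegE (bigD1 i) //= leq_addr.
have separate n m : (n < B a)%N -> m \in msupp (D n (polyalgC d a) : mpoly d A) ->
    (weight m0 + n0 = weight m + n)%N -> n = n0 /\ m = m0.
  move=> ltn pm wE.
  have N_gtB n' : (n' < B a)%N -> (n' < N)%N.
    by move=> ltn'; rewrite ltnS (leq_trans (ltnW ltn')) // leq_maxl.
  have n_eq : n = n0.
    have := congr1 (modn^~ N) wE; rewrite /weight !modnMDl.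
    by rewrite !modn_small ?N_gtB.
  split=> //; move: wE; rewrite n_eq => /addIn/eqP; rewrite eqn_pmul2r //.
  move=> /eqP wE; apply/mnmP; apply: (digits_inj _ _ (esym wE)) => i.
    exact: N_deg pm.
  by apply: (N_deg n0) => //; rewrite mcoeff_msupp.
have := aML _ D'_LND (weight m0 + n0)%N; rewrite /= => /(_ (ltn_addl _ n0_gt0)).
rewrite D'E /P (horner_coef_wide _ (size_poly _ _)) coef_sum.
rewrite (bigD1 (Ordinal n0_lt)) //= QE ev_coef.
rewrite (bigD1_seq m0) ?msupp_uniq ?mcoeff_msupp //= eqxx mulr1n.
rewrite big1_seq => [|m /andP[m_neq pm]]; last first.
  case: eqP => // /(separate _ _ n0_lt pm)[_ m_eq].
  by rewrite m_eq eqxx in m_neq.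
rewrite addr0 big1 ?addr0; first by move=> p0; rewrite p0 eqxx in pm0.
move=> n n_neq; rewrite QE ev_coef big1_seq // => m /andP[_ pm].
case: eqP => // /(separate _ _ (ltn_ord n) pm)[n_eq _].
by case/eqP: n_neq; apply: val_inj.
Qed.

End MakarLimanovPolynomial.

(** * Linear algebra over the centre of a prime ring *)

Section Centre.
Variables (k : fieldType) (A : algType k).

Lemma centreD (a b : A) : centre A a -> centre A b -> centre A (a + b).
Proof. by move=> aZ bZ c; rewrite /GRing.comm mulrDl mulrDr aZ bZ. Qed.

Lemma centreN (a : A) : centre A a -> centre A (- a).
Proof. by move=> aZ c; rewrite /GRing.comm mulNr mulrN aZ. Qed.

Lemma centreM (a b : A) : centre A a -> centre A b -> centre A (a * b).
Proof. by move=> aZ bZ c; rewrite /GRing.comm -mulrA bZ !mulrA aZ. Qed.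

Lemma centre0 : centre A 0.
Proof. by move=> c; rewrite /GRing.comm mul0r mulr0. Qed.

Lemma centre1 : centre A 1.
Proof. by move=> c; rewrite /GRing.comm mul1r mulr1. Qed.

Lemma centreX (a : A) n : centre A a -> centre A (a ^+ n).
Proof.
by move=> aZ; elim: n => [|n IH]; [exact: centre1 | rewrite exprS; exact: centreM].
Qed.

Lemma centre_sum (I : Type) (r : seq I) (P : pred I) (F : I -> A) :
  (forall i, P i -> centre A (F i)) -> centre A (\sum_(i <- r | P i) F i).
Proof. by move=> FZ; elim/big_ind: _ => //; [exact: centre0 | exact: centreD]. Qed.

Definition central_regular :=
  forall z a : A, centre A z -> z != 0 -> z * a = 0 -> a = 0.

(** If z a = 0 with z central, the ideal z A and the annihilator of z, which is
    also a two-sided ideal, have zero product. *)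
Lemma prime_central_regular : prime_ring A -> central_regular.
Proof.
move=> A_prime z a zZ z_neq0 za0.
pose I := [set x | exists y, x = z * y]; pose J := [set x | z * x = 0].
have I_ideal : two_sided_ideal I.
  have I_zmod : GRing.zmod_closed [in I].
    split=> [|x y]; rewrite !inE; first by exists 0; rewrite mulr0.
    by move=> [x' ->] [y' ->]; exists (x' - y'); rewrite mulrBr.
  split; split=> // b _ [x ->]; last by exists (x * b); rewrite mulrA.
  by exists (b * x); rewrite !mulrA zZ.
have J_ideal : two_sided_ideal J.
  have J_zmod : GRing.zmod_closed [in J].
    split=> [|x y]; rewrite !inE /J /=; first by rewrite mulr0.
    by move=> x0 y0; rewrite mulrBr x0 y0 subr0.
  split; split=> // b x; rewrite /J /= => x0; last by rewrite mulrA x0 mul0r.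
  by rewrite mulrA zZ -mulrA x0 mulr0.
have IJ0 x y : I x -> J y -> x * y = 0.
  by move=> [x' ->] y0; rewrite zZ -mulrA y0 mulr0.
have [I0|J0] := A_prime I J I_ideal J_ideal IJ0.
- have : I z by exists 1; rewrite mulr1.
  by rewrite I0 /= => z0; rewrite z0 eqxx in z_neq0.
- have : J a by [].
  by rewrite J0.
Qed.

(** More vectors than coordinates are dependent over the centre, by elimination
    without division: the centre is a domain, and clearing the coordinate [j]
    with the pivot [u i0 j] multiplies the other vectors by it. *)
Lemma central_dependency (I J : finType) (v : I -> J -> A) :
    central_regular -> (forall i j, centre A (v i j)) -> (#|J| < #|I|)%N ->
  exists c : I -> A, [/\ forall i, centre A (c i), exists i, c i != 0
    & forall j, \sum_i c i * v i j = 0].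
Proof.
move=> Areg vZ ltJI.
suff dep (s : seq J) (S : {set I}) (u : I -> J -> A) :
    (forall i j, centre A (u i j)) -> (size s < #|S|)%N ->
    exists c : I -> A, [/\ forall i, centre A (c i), exists i, c i != 0,
      forall i, i \notin S -> c i = 0 & forall j, j \in s -> \sum_i c i * u i j = 0].
  have [|c [cZ c_neq0 _ c_rel]] := dep (enum J) [set: I]%SET v vZ.
    by rewrite -cardE cardsT.
  by exists c; split=> // j; apply: c_rel; rewrite mem_enum.
elim: s S u => [|j s IH] S u uZ ltS.
  have /card_gt0P[i0 i0S] := ltS.
  exists (fun i => if i == i0 then 1 else 0); split=> //.
  - by move=> i; case: ifP => _; [exact: centre1 | exact: centre0].
  - by exists i0; rewrite eqxx oner_neq0.
  - by move=> i iS; case: eqP => // ii0; rewrite ii0 i0S in iS.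
have [/existsP[i0 /andP[i0S ui0]]|] := 
    boolP [exists i, (i \in S) && (u i j != 0)]; last first.
  rewrite negb_exists => /forallP u0.
  have [|c [cZ c_neq0 cS c_rel]] := IH S u uZ; first exact: leq_trans ltS.
  exists c; split=> // l; rewrite inE => /predU1P[-> |]; last exact: c_rel.
  rewrite big1 // => i _; have [iS|/cS ->] := boolP (i \in S); last by rewrite mul0r.
  by have := u0 i; rewrite iS negbK => /eqP ->; rewrite mulr0.
pose w i l := u i0 j * u i l - u i j * u i0 l.
have [||c [cZ [i1 c_i1] cS c_rel]] := IH (S :\ i0)%SET w.
- by move=> i l; apply: centreD; [|apply: centreN]; apply: centreM.
- by have := ltS; rewrite (cardsD1 i0) i0S.
have c_i0 : c i0 = 0 by apply: cS; rewrite !inE eqxx.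
have i1_neq : i1 != i0 by apply: contraNneq c_i1 => ->; rewrite c_i0.
pose c' i := if i == i0 then - \sum_l c l * u l j else c i * u i0 j.
have c'E l : \sum_i c' i * u i l = \sum_i c i * w i l.
  have -> : \sum_i c i * w i l =
      \sum_i (c i * u i0 j) * u i l - \sum_i c i * u i j * u i0 l.
    by rewrite -sumrB; apply: eq_bigr => i _; rewrite mulrBr !mulrA.
  rewrite (bigD1 i0) //= /c' eqxx addrC [in RHS](bigD1 i0) //= c_i0 !mul0r add0r.
  rewrite mulNr mulr_suml; congr (_ - _).
  by apply: eq_bigr => i /negbTE ->.
exists c'; split.
- move=> i; rewrite /c'; case: ifP => _; last exact: centreM.
  by apply/centreN/centre_sum => l _; apply: centreM.
- exists i1; rewrite /c' (negbTE i1_neq); apply: contra c_i1 => /eqP.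
  by rewrite cZ => /(Areg _ _ (uZ _ _) ui0) ->.
- move=> i iS; rewrite /c'; case: eqP => [ii0|_]; first by rewrite ii0 i0S in iS.
  by rewrite cS ?mul0r // inE (negbTE iS) andbF.
- move=> l; rewrite inE c'E => /predU1P[-> |]; last exact: c_rel.
  by rewrite big1 // => i _; rewrite /w uZ subrr mulr0.
Qed.

End Centre.

(** * Central elements and degrees in a polynomial algebra *)

Section PolyalgCentre.
Variables (k : fieldType) (A : algType k) (d : nat).

Lemma mcoeff_mulC (p : polyalg A d) (a : A) m :
  mcoeff m (p * polyalgC d a) = mcoeff m p * a.
Proof.
rewrite [in RHS](mpolyE p) {1}(mpolyE p) mulr_suml !raddf_sum mulr_suml.
apply: eq_bigr => i _ /=; rewrite -mul_mpolyC -mulrA -[mpolyX A i * _]commr_mpolyX.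
by rewrite mulrA -mpolyCM !mcoeffCM !mcoeffX -!mulrA -commr_nat.
Qed.

Lemma centre_mcoeff (p : polyalg A d) m :
  centre (polyalg A d) p -> centre A (mcoeff m p).
Proof.
move=> pZ a; have := congr1 (mcoeff m) (pZ (polyalgC d a)).
by rewrite mcoeffCM mcoeff_mulC.
Qed.

Lemma polyalgC_centre (a : A) : centre A a -> centre (polyalg A d) (polyalgC d a).
Proof.
by move=> aZ p; apply/mpolyP => m; rewrite mcoeffCM mcoeff_mulC; apply: aZ.
Qed.

Lemma centre_of_polyalgC (a : A) :
  centre (polyalg A d) (polyalgC d a) -> centre A a.
Proof. by move=> /(centre_mcoeff mnm0); rewrite [mcoeff _ _]polyalgCK. Qed.

Lemma centre_polyalgX m : centre (polyalg A d) (mpolyX A m).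
Proof. by move=> p; apply/commr_sym/commr_mpolyX. Qed.

Lemma constant_termX i : constant_term (mpolyX A (mnm1 i) : polyalg A d) = 0.
Proof. by rewrite /constant_term mcoeffX -mdeg_eq0 mdeg1. Qed.

Lemma polyalgX_prod m :
  mpolyX A m = \prod_(i < d) (mpolyX A (mnm1 i) : polyalg A d) ^+ m i :> polyalg A d.
Proof. exact: mpolyXE_id. Qed.

(** A relation reads c_0 + q p = 0.  If q were nonzero, the leading term of q p
    would be the product of the leading terms, of positive degree.  So q = 0,
    c_0 = 0, and q is a shorter relation. *)
Lemma nonconstant_transcendental (p : polyalg A d) (N : nat) (c : nat -> A) :
    GRing.rreg (mcoeff (mlead p) p) -> mlead p != mnm0 ->
    \sum_(i < N) polyalgC d (c i) * p ^+ i = 0 ->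
  forall i, (i < N)%N -> c i = 0.
Proof.
move=> lc_reg lead_neq0; elim: N c => [//|N IH] c.
rewrite big_ord_recl expr0 mulr1 => c_rel.
pose q := \sum_(i < N) polyalgC d (c i.+1) * p ^+ i.
have {}c_rel : polyalgC d (c 0%N) + q * p = 0.
  rewrite -[RHS]c_rel mulr_suml; congr (_ + _); apply: eq_bigr => i _.
  by rewrite -mulrA -exprSr.
have q0 : q = 0.
  apply/eqP; apply: contraT => q_neq0.
  have := congr1 (mcoeff (mnm_add (mlead q) (mlead p))) c_rel.
  rewrite mcoeffD mleadcM mcoeffC -mdeg_eq0 mdegD addn_eq0 !mdeg_eq0.
  rewrite (negbTE lead_neq0) andbF mulr0 add0r [RHS]mcoeff0.
  by move=> /eqP; rewrite mulIr_eq0 // mleadc_eq0 (negbTE q_neq0).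
case=> [_|i]; last exact: (IH (fun i => c i.+1)).
move: c_rel; rewrite q0 mul0r addr0 => /(congr1 (@constant_term k A d)).
by rewrite polyalgCK rmorph0.
Qed.

Definition degree (p : polyalg A d) : nat := mdeg (mlead p).

Lemma degreeM_le (p q : polyalg A d) : (degree (p * q)%R <= degree p + degree q)%N.
Proof. by have /lemc_mdeg := mleadM_le p q; rewrite mdegD. Qed.

Lemma degreeX_le (p : polyalg A d) n : (degree (p ^+ n)%R <= degree p * n)%N.
Proof. by have /lemc_mdeg := mleadX_le p n; rewrite mdegMn. Qed.

Lemma degree_prod_le (I : finType) (F : I -> polyalg A d) :
  (degree (\prod_i F i)%R <= \sum_i degree (F i))%N.
Proof. by have /lemc_mdeg := mlead_prod_le (index_enum I) xpredT F; rewrite mdeg_sum. Qed.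

Lemma mcoeff_gt_degree (p : polyalg A d) m : (degree p < mdeg m)%N -> mcoeff m p = 0.
Proof.
move=> lt_pm; apply: mcoeff_gt_mlead; rewrite ltNge; apply/negP => /lemc_mdeg.
by rewrite leqNgt lt_pm.
Qed.

Lemma const_of_lead0 (p : polyalg A d) : mlead p = mnm0 -> 
  p = polyalgC d (constant_term p).
Proof.
move=> p0; apply: msize1_polyC.
have [->|p_neq0] := eqVneq p 0; first by rewrite msize0.
by rewrite -mlead_deg // p0 mdeg0.
Qed.

Lemma card_bmultinom_le K : (#|{: bmultinom d K}| <= K ^ d)%N.
Proof.
have val_lt (m : bmultinom d K) i : (m i < K)%N.
  by apply: leq_trans (bmdeg m); rewrite ltnS mdegE (bigD1 i) //= leq_addr.
pose f (m : bmultinom d K) : {ffun 'I_d -> 'I_K} := [ffun i => Ordinal (val_lt m i)].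
have f_inj : injective f.
  move=> m m' /ffunP mm'; apply/val_inj/mnmP => i.
  by have := mm' i; rewrite !ffunE => -[].
by have := leq_card f f_inj; rewrite card_ffun !card_ord.
Qed.

End PolyalgCentre.

(** * Cancellation when the centre of A is mapped to constants *)

Section CentreUnderIso.
Variables (k : fieldType) (A B : algType k) (d : nat).
Variables (phi : {lrmorphism polyalg A d -> polyalg B d})
  (psi : {lrmorphism polyalg B d -> polyalg A d}).
Hypothesis (phiK : cancel phi psi) (psiK : cancel psi phi).
Hypothesis A_reg : central_regular A.
Hypothesis phiZ : forall a, centre A a ->
  exists2 b, centre B b & phi (polyalgC d a) = polyalgC d b.

Lemma centre_transport (C D : algType k) (f : {rmorphism C -> D}) g :
  cancel g f -> forall c, centre C c -> centre D (f c).
Proof. by move=> gK c cZ y; rewrite -(gK y) /GRing.comm -!rmorphM cZ. Qed.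

(** Suppose that the image [p] of [b] under [psi] is not a constant.  Among the
    products of powers below N of [p] and of the [d] elements psi(x_i) there are
    N^(d+1) candidates, all living in the polynomials of degree O(N) in [d]
    variables, where there are only O(N^d) monomials.  For [N] large they
    satisfy a linear relation with central coefficients.  Applying [phi] turns
    psi(x_i) into x_i, [p] into the constant [b], and keeps the coefficients
    constant, so the relation splits along the monomials in the x_i into
    relations between the powers of [p] alone, against
    [nonconstant_transcendental]. *)
Lemma centre_inverse b : centre B b ->
  exists2 a, centre A a & psi (polyalgC d b) = polyalgC d a.
Proof.
move=> bZ; pose p := psi (polyalgC d b).
have pZ : centre _ p.
  by apply: (centre_transport (f := psi) phiK); apply: polyalgC_centre.
have [p_lead|p_lead] := eqVneq (mlead p) mnm0.
  by exists (constant_term p); [exact: centre_mcoeff | exact: const_of_lead0].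
have lcZ := centre_mcoeff (mlead p) pZ.
have lc_reg : GRing.rreg (mcoeff (mlead p) p).
  apply: mulIr0_rreg => a; rewrite -lcZ => /(A_reg lcZ).
  apply; rewrite mleadc_eq0; apply: contra p_lead => /eqP ->.
  by rewrite mlead0.
pose x i : polyalg A d := psi (mpolyX B (mnm1 i)).
pose D := maxn (degree p) (\max_i degree (x i)).
(* The products have degree < E N, and (E N)^d < N^(d+1) since E^d < N. *)
pose E := (D * d.+1).+1; pose N := (E ^ d).+1.
pose mon (f : {ffun 'I_d -> 'I_N}) := Multinom (mktuple (fun i => f i : nat)).
pose v (fi : {ffun 'I_d -> 'I_N} * 'I_N) : polyalg A d :=
  psi (mpolyX B (mon fi.1)) * p ^+ fi.2.
have vZ fi : centre _ (v fi).
  apply: centreM; last exact: centreX.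
  by apply: (centre_transport (f := psi) phiK); apply: centre_polyalgX.
have v_deg fi : (degree (v fi) <= D * d.+1 * N)%N.
  have x_deg i : (degree (x i) <= D)%N.
    by apply: leq_trans (leq_maxr _ _); apply: (leq_bigmax i).
  rewrite mulnS mulnDl addnC; apply: leq_trans (degreeM_le _ _) (leq_add _ _); last first.
    apply: leq_trans (degreeX_le _ _) (leq_mul _ _); first exact: leq_maxl.
    exact: ltnW.
  rewrite polyalgX_prod rmorph_prod; apply: leq_trans (degree_prod_le _) _.
  rewrite (mulnC D) -mulnA -[X in (_ <= X * _)%N]card_ord -sum_nat_const.
  apply: leq_sum => i _; rewrite rmorphXn; apply: leq_trans (degreeX_le _ _) _.
  by apply: leq_mul; [exact: x_deg | rewrite mnmE ltnW].
have card_lt : (#|{: bmultinom d (E * N)}| < #|{: {ffun 'I_d -> 'I_N} * 'I_N}|)%N.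
  rewrite card_prod card_ffun !card_ord; apply: leq_ltn_trans (card_bmultinom_le _ _) _.
  by rewrite expnMn mulnC ltn_pmul2l ?expn_gt0.
have [c [cZ [[f i] c_neq0] c_rel]] :=
  central_dependency A_reg
    (fun fi (m : bmultinom d (E * N)) => centre_mcoeff m (vZ fi)) card_lt.
have {}c_rel : \sum_fi polyalgC d (c fi) * v fi = 0.
  apply/mpolyP => m; rewrite mcoeff0 raddf_sum /=.
  have [lt_m|le_m] := ltnP (mdeg m) (E * N).
    by rewrite -[RHS](c_rel (BMultinom lt_m)); apply: eq_bigr => fi _; rewrite mcoeffCM.
  rewrite big1 // => fi _; rewrite mcoeffCM mcoeff_gt_degree ?mulr0 //.
  apply: leq_ltn_trans (v_deg _) (leq_trans _ le_m).
  by rewrite ltn_pmul2r.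
have phiC fi : exists u, phi (polyalgC d (c fi)) = polyalgC d u.
  by have [u _ cu] := phiZ (cZ fi); exists u.
have [c' c'E] := choice phiC.
have {}c_rel : \sum_(i < N) c' (f, i) * b ^+ i = 0.
  have := congr1 (fun q => mcoeff (mon f) (phi q)) c_rel.
  rewrite rmorph0 [RHS]mcoeff0 rmorph_sum raddf_sum /= => sum0.
  rewrite -[RHS]sum0 {sum0}.
  pose F (g : {ffun 'I_d -> 'I_N}) (i : 'I_N) :=
    if g == f then c' (g, i) * b ^+ i else 0.
  have FE fi : mcoeff (mon f) (phi (polyalgC d (c fi) * v fi)) = F fi.1 fi.2.
    case: fi => g j; rewrite /F /v /= !rmorphM /= c'E rmorphXn /= /p !psiK -rmorphXn /=.
    rewrite mcoeffCM mcoeff_mulC mcoeffX.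
    have -> : (mon g == mon f) = (g == f).
      apply/eqP/eqP => [/mnmP gf|-> //]; apply/ffunP => l; apply: val_inj.
      by have := gf l; rewrite !mnmE.
    by case: eqP; rewrite ?mul1r // mul0r mulr0.
  under [RHS]eq_bigr do rewrite FE.
  rewrite -(pair_bigA _ F) /= (bigD1 f) //= [X in _ + X]big1 ?addr0 => [|g /negbTE gf].
    by apply: eq_bigr => j _; rewrite /F eqxx.
  by rewrite big1 // => j _; rewrite /F gf.
have p_rel : \sum_(j < N) polyalgC d (c (f, inord j)) * p ^+ j = 0.
  have := congr1 (fun u => psi (polyalgC d u)) c_rel.
  rewrite !rmorph0 => sum0; rewrite -[RHS]sum0 !rmorph_sum; apply: eq_bigr => j _.
  by rewrite !rmorphM /= -c'E phiK /p !rmorphXn inord_val.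
have := nonconstant_transcendental (c := fun j => c (f, inord j))
  lc_reg p_lead p_rel (ltn_ord i).
by rewrite inord_val => c0; rewrite c0 eqxx in c_neq0.
Qed.

(** Both algebras are recovered as the same quotient.  Let [eps] set the
    variables of the second polynomial algebra to 0; the central elements
    eps(phi(x_i)) of [B] come from central elements [e i] of [A], and [eta] sets
    the variables of the first algebra to the [e i].  Then eps o phi only
    depends on the value of [eta], and conversely eta o psi only depends on the
    value of [eps], so the constants of [A] and of [B] correspond. *)
Lemma alg_iso_of_stable_iso : alg_iso A B.
Proof.
have centralX i : exists a, centre A a /\
    phi (polyalgC d a) = polyalgC d (constant_term (phi (mpolyX A (mnm1 i)))).
  have [|a aZ aE] := @centre_inverse (constant_term (phi (mpolyX A (mnm1 i)))).
    apply: centre_mcoeff; apply: (centre_transport (f := phi) psiK).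
    exact: centre_polyalgX.
  by exists a; split=> //; rewrite -aE psiK.
have [e e_central] := choice centralX.
have eZ i : centre A (e i) := (e_central i).1.
have eE i := (e_central i).2.
have e_comm i x : GRing.comm x (e i) by apply: commr_sym; apply: eZ.
pose eta : {rmorphism polyalg A d -> A} := central_subst idfun e_comm.
have etaC a : eta (polyalgC d a) = a by exact: central_substC.
have eps_phi x : constant_term (phi x) = constant_term (phi (polyalgC d (eta x))).
  pose F : {rmorphism polyalg A d -> B} := @constant_term k B d \o phi.
  pose G : {rmorphism polyalg A d -> B} :=
    @constant_term k B d \o phi \o @polyalgC k A d \o eta.
  apply: (polyalg_morphism_ext (F := F) (G := G)) => [a|i] /=; first by rewrite etaC.
  by rewrite [eta _]central_substX eE polyalgCK.
have eta_psiX i : eta (psi (mpolyX B (mnm1 i))) = 0.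
  (* eps(phi(.)) is injective on central constants, and vanishes here. *)
  have etaZ : centre A (eta (psi (mpolyX B (mnm1 i)))).
    apply: (centre_transport (f := eta) etaC); apply: (centre_transport (f := psi) phiK).
    exact: centre_polyalgX.
  have [b _ bE] := phiZ etaZ.
  have := eps_phi (psi (mpolyX B (mnm1 i))); rewrite psiK bE polyalgCK => b0.
  by rewrite -[LHS](polyalgCK d) -[polyalgC _ _]phiK bE -b0 constant_termX !rmorph0.
have eta_psi y : eta (psi y) = eta (psi (polyalgC d (constant_term y))).
  pose F : {rmorphism polyalg B d -> A} := eta \o psi.
  pose G : {rmorphism polyalg B d -> A} :=
    eta \o psi \o @polyalgC k B d \o @constant_term k B d.
  apply: (polyalg_morphism_ext (F := F) (G := G)) => [b|i]; first by rewrite /= polyalgCK.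
  rewrite [LHS]eta_psiX /G /= constant_termX.
  by rewrite -[RHS]/(eta (psi (polyalgC d 0))) !rmorph0.
pose f : {lrmorphism A -> B} := @constant_term k B d \o phi \o @polyalgC k A d.
exists f; exists (fun b => eta (psi (polyalgC d b))).
- by move=> a; rewrite /= -eta_psi phiK etaC.
- by move=> b; rewrite /= -eps_phi psiK polyalgCK.
Qed.

End CentreUnderIso.

(** * Conclusion *)

Lemma iso_MLH' (k : fieldType) (A B : algType k) (f : {lrmorphism A -> B})
    (g : {lrmorphism B -> A}) :
  cancel f g -> cancel g f -> forall a, MLH' A a -> MLH' B (f a).
Proof.
move=> fK gK a aML D [[D0 DM] DN] n n_gt0.
pose D' i : {linear A -> A} := g \o D i \o f.
have D'_LND : LNDH' A D'.
  split; first split.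
  - by move=> x; rewrite /= D0 fK.
  - move=> m x y; rewrite /= rmorphM DM rmorph_sum.
    by apply: eq_bigr => i _; rewrite rmorphM.
  - move=> x; have [N DN0] := DN (f x).
    by exists N => m le_m; rewrite /= DN0 ?linear0.
have /= := aML _ D'_LND n n_gt0.
by move=> /(congr1 f); rewrite gK linear0.
Qed.

Theorem proposition2p7 (k : fieldType) (A : algType k)
    (A_prime : prime_ring A) (A_fg : affine [set: A])
    (Z_infinite : infinite_set (centre A)) :
  (forall d : nat, (1 <= d)%N ->
     MLH' (polyalg A d) = [set polyalgC d a | a in MLH' A]) /\
  (left_goldie A -> (GKdim A < +oo)%E -> affine (centre A) ->
   MLH'Z A = centre A \/ MLH' A = [set: A] ->
   strongly_cancellative A).
Proof.
split=> [d _|_ _ _ A_rigid d _ B [phi /inverse_lrmorphism[psi [phiK psiK]]]].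
  by apply/seteqP; split; [exact: polyalg_MLH'_sub | exact: polyalgC_MLH'].
apply: (alg_iso_of_stable_iso phiK psiK) => [|a aZ].
  exact: prime_central_regular.
have aML : MLH' A a.
  by case: A_rigid => [AZ|->] //; move: aZ; rewrite -AZ => -[].
have [|b _ bE] := @polyalg_MLH'_sub k B d (phi (polyalgC d a)).
  by apply: (iso_MLH' phiK psiK); apply: polyalgC_MLH'; exists a.
exists b => //; apply: (@centre_of_polyalgC k B d); rewrite bE.
by apply: (centre_transport (f := phi) psiK); apply: polyalgC_centre.
Qed.
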